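(* Let $A,B\in\mathbb{C}^{n\times n}$. Then: (a) $AA^{(B)}$ is the orthogonal projector onto $R(AB)$; (b) $A^{(B)}A$ is the oblique projector onto $R(BB^\dagger A^* )$ along $N(B^*A^*A)$.
   Context: $R(M)$, $N(M)$, $M^*$, $M^\dagger$ denote the range, null space, conjugate transpose and Moore-Penrose inverse of a complex matrix $M$. The oblique projector onto $T$ along $S$ is the idempotent matrix with range $T$ and null space $S$. For $A,B\in\mathbb{C}^{n\times n}$, the generalized inverse of $A$ with respect to $B$ is $A^{(B)}:=(ABB^\dagger)^\dagger$. *)

(* Defs.v *)
From mathcomp Require Import all_boot all_order all_algebra.
From mathcomp Require Import classical_sets.

Set Implicit Arguments.
Unset Strict Implicit.
Unset Printing Implicit Defensive.

Import Order.TTheory GRing.Theory Num.Theory.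
Local Open Scope ring_scope.
Local Open Scope sesquilinear_scope.
Local Open Scope classical_set_scope.

(* [M ^t*] is the conjugate transpose of [spectral]. Matrices act on column
   vectors, so ranges and null spaces are sets of column vectors (unlike the
   row spaces of [mxalgebra]). *)

Section Range.
Variables (C : numClosedFieldType) (m n : nat) (M : 'M[C]_(m, n)).

Definition mxrange : set 'cV[C]_m := range (fun x : 'cV[C]_n => M *m x).

Definition mxnull : set 'cV[C]_n := [set x | M *m x = 0].

End Range.

Section Projector.
Variables (C : numClosedFieldType) (n : nat).

Definition orthocomp (T : set 'cV[C]_n) : set 'cV[C]_n :=
  [set x | forall y, T y -> y ^t* *m x = 0].

Definition oblique_projector (P : 'M[C]_n) (T S : set 'cV[C]_n) : Prop :=
  [/\ P *m P = P, mxrange P = T & mxnull P = S].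

Definition orthogonal_projector (P : 'M[C]_n) (T : set 'cV[C]_n) : Prop :=
  oblique_projector P T (orthocomp T).

End Projector.

Section MoorePenrose.
Variable C : numClosedFieldType.

Definition penrose m n (A : 'M[C]_(m, n)) (X : 'M[C]_(n, m)) : bool :=
  [&& A *m X *m A == A, X *m A *m X == X,
      (A *m X) ^t* == A *m X & (X *m A) ^t* == X *m A].

Lemma penroseP m n (A : 'M[C]_(m, n)) (X : 'M[C]_(n, m)) :
  reflect [/\ A *m X *m A = A, X *m A *m X = X,
              (A *m X) ^t* = A *m X & (X *m A) ^t* = X *m A] (penrose A X).
Proof.
by apply: (iffP and4P) => [[/eqP ? /eqP ? /eqP ? /eqP ?]|[-> -> -> ->]].
Qed.

Lemma trmxC_mul m n p (A : 'M[C]_(m, n)) (B : 'M[C]_(n, p)) :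
  (A *m B) ^t* = B ^t* *m A ^t*.
Proof. by rewrite trmx_mul map_mxM. Qed.

Lemma trmxC_inv n (A : 'M[C]_n) : (invmx A) ^t* = invmx (A ^t*).
Proof. by rewrite trmx_inv map_invmx. Qed.

Lemma gram_eq0 m n (A : 'M[C]_(m, n)) : A *m A ^t* = 0 -> A = 0.
Proof.
move=> /matrixP A0; apply/matrixP => i j; rewrite mxE.
have := A0 i i; rewrite !mxE => /eqP; rewrite psumr_eq0 => [/allP/(_ j)|k _].
  by rewrite mem_index_enum !mxE -normCK sqrf_eq0 normr_eq0 => /(_ isT)/eqP.
by rewrite !mxE mul_conjC_ge0.
Qed.

Lemma gram_unit m n (A : 'M[C]_(m, n)) : row_free A -> A *m A ^t* \in unitmx.
Proof.
move=> fA; rewrite -row_free_unit -kermx_eq0; apply/eqP.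
set K := kermx _; have K0 : K *m (A *m A ^t*) = 0 by exact: mulmx_ker.
have /eqP : K *m A = 0.
  by apply: gram_eq0; rewrite trmxC_mul mulmxA -(mulmxA K) K0 mul0mx.
by rewrite mulmx_free_eq0 // => /eqP.
Qed.

Lemma penrose_full_rank m r n (L : 'M[C]_(m, r)) (U : 'M[C]_(r, n)) :
  row_full L -> row_free U ->
  penrose (L *m U)
    (U ^t* *m invmx (U *m U ^t*) *m (invmx (L ^t* *m L) *m L ^t*)).
Proof.
move=> fL fU; have Uu := gram_unit fU.
have Lu : L ^t* *m L \in unitmx.
  have := @gram_unit _ _ (L ^t*); rewrite trmxCK; apply.
  by rewrite /row_free mxrank_map mxrank_tr.
set V := U ^t* *m _; set W := invmx _ *m _.
have UV : U *m V = 1%:M by rewrite mulmxA mulmxV.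
have WL : W *m L = 1%:M by rewrite -mulmxA mulVmx.
have AX : L *m U *m (V *m W) = L *m W by rewrite -mulmxA (mulmxA U) UV mul1mx.
have XA : V *m W *m (L *m U) = V *m U by rewrite -mulmxA (mulmxA W) WL mul1mx.
apply/penroseP; split.
- by rewrite AX -mulmxA (mulmxA W) WL mul1mx.
- by rewrite XA -mulmxA (mulmxA U) UV mul1mx.
- by rewrite AX /W mulmxA !trmxC_mul trmxC_inv trmxC_mul !trmxCK mulmxA.
- by rewrite XA /V !trmxC_mul trmxC_inv trmxC_mul !trmxCK mulmxA.
Qed.

Lemma penrose_exists m n (A : 'M[C]_(m, n)) : exists X, penrose A X.
Proof.
have := penrose_full_rank (col_base_full A) (row_base_free A).
by rewrite mulmx_base => AX; eexists; exact: AX.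
Qed.

Lemma penrose_unique m n (A : 'M[C]_(m, n)) X Y :
  penrose A X -> penrose A Y -> X = Y.
Proof.
move=> /penroseP[X1 X2 X3 X4] /penroseP[Y1 Y2 Y3 Y4].
have AXY : A *m X = A *m Y.
  by rewrite -X3 -{1}Y1 -(mulmxA _ A X) trmxC_mul X3 Y3 mulmxA X1.
have XAY : X *m A = Y *m A.
  by rewrite -X4 -{1}Y1 -(mulmxA A) mulmxA trmxC_mul X4 Y4 -mulmxA (mulmxA A) X1.
by rewrite -X2 XAY -mulmxA AXY mulmxA Y2.
Qed.

(* The Moore-Penrose inverse: the unique solution of the Penrose equations. *)
Definition mpinv m n (A : 'M[C]_(m, n)) : 'M[C]_(n, m) :=
  xchoose (penrose_exists A).

Lemma mpinvP m n (A : 'M[C]_(m, n)) : penrose A (mpinv A).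
Proof. exact: xchooseP. Qed.

Definition geninv n (A B : 'M[C]_n) : 'M[C]_n := mpinv (A *m B *m mpinv B).

End MoorePenrose.

(* Main.v *)
Require Import Defs.
From mathcomp Require Import all_boot all_order all_algebra.
From mathcomp Require Import classical_sets.
From mathcomp Require Import reals.
From mathcomp.real_closed Require Import complex.

Local Open Scope ring_scope.
Local Open Scope sesquilinear_scope.

(** Write M^H for the conjugate transpose of M, P = B B^+ for the orthogonal
    projector onto R(B), and X = (A P)^+ for the generalized inverse of A with
    respect to B.  A Moore-Penrose inverse M^+ has the same range and the same
    null space as M^H, because each of the two factors through the other on
    both sides ([mpinv_adjl], [adj_mpinvl], [mpinv_adjr], [adj_mpinvr]).  Taking M = A P, the range of X is that of
    P A^H, so it lies in R(P) and P X = X ([geninv_absorb]).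

    This absorption gives everything.  First, A X = A P X = M M^+ is Hermitian
    and idempotent with range R(A P) = R(A B).  Next, X A X = X M X = X, so X A
    is idempotent with R(X A) = R(X) = R(P A^H).  Finally, X A v = 0 iff
    M^H A v = P A^H A v = 0, and P and B^H have the same null space. *)

Section Adjoint.
Context {C : numClosedFieldType}.

(** Ranges and null spaces are compared below by exhibiting each matrix as a
    multiple of the other, which reduces their equality to matrix identities. *)
Lemma mxrange_eq {m n p} {M : 'M[C]_(m, n)} {N : 'M[C]_(m, p)}
    (K : 'M_(p, n)) (L : 'M_(n, p)) :
  M = N *m K -> N = M *m L -> mxrange M = mxrange N.
Proof.
move=> MN NM; apply/seteqP; split=> _ [x _ <-].
  by exists (K *m x); rewrite // mulmxA -MN.
by exists (L *m x); rewrite // mulmxA -NM.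
Qed.

Lemma mxnull_eq {m n p} {M : 'M[C]_(m, n)} {N : 'M[C]_(p, n)}
    (K : 'M_(m, p)) (L : 'M_(p, m)) :
  M = K *m N -> N = L *m M -> mxnull M = mxnull N.
Proof.
move=> MN NM; apply/seteqP; split=> x; rewrite /mxnull /= => x0.
  by rewrite NM -mulmxA x0 mulmx0.
by rewrite MN -mulmxA x0 mulmx0.
Qed.

(** For y = M z, the product y^H x is z^H (M^H x), and z is arbitrary; taking
    z = M^H x shows that M^H x has norm zero. *)
Lemma orthocomp_mxrange {m} (M : 'M[C]_m) :
  orthocomp (mxrange M) = mxnull (M ^t*).
Proof.
apply/seteqP; split=> x; rewrite /mxnull /orthocomp /= => x0; last first.
  by move=> _ [z _ <-]; rewrite trmxC_mul -mulmxA x0 mulmx0.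
have w0 := x0 (M *m (M ^t* *m x)) (imageT _ _).
rewrite trmxC_mul -mulmxA in w0.
have := @gram_eq0 _ _ _ ((M ^t* *m x) ^t*); rewrite trmxCK => /(_ w0) h.
by rewrite -[LHS]trmxCK h trmx0 map_mx0.
Qed.

Lemma hermitian_orthogonal_projector {n} {P : 'M[C]_n} :
  P *m P = P -> P ^t* = P -> orthogonal_projector P (mxrange P).
Proof. by move=> PP hP; split=> //; rewrite orthocomp_mxrange hP. Qed.

End Adjoint.

Section MoorePenroseFactorizations.
Context {C : numClosedFieldType} {m n : nat} (M : 'M[C]_(m, n)).
Local Notation X := (mpinv M).

Lemma mpinv_adjl : X = M ^t* *m (X ^t* *m X).
Proof.
by have /penroseP[_ X2 _ X4] := mpinvP M; rewrite mulmxA -trmxC_mul X4.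
Qed.

Lemma mpinv_adjr : X = X *m X ^t* *m M ^t*.
Proof.
have /penroseP[_ X2 X3 _] := mpinvP M.
by rewrite -mulmxA -trmxC_mul X3 mulmxA.
Qed.

Lemma adj_mpinvl : M ^t* = X *m (M *m M ^t*).
Proof.
have /penroseP[X1 _ _ X4] := mpinvP M.
by rewrite mulmxA -X4 -trmxC_mul mulmxA X1.
Qed.

Lemma adj_mpinvr : M ^t* = M ^t* *m M *m X.
Proof.
have /penroseP[X1 _ X3 _] := mpinvP M.
by rewrite -mulmxA -X3 -trmxC_mul X1.
Qed.

Lemma mulmx_mpinv_orthogonal :
  orthogonal_projector (M *m X) (mxrange M).
Proof.
have /penroseP[X1 _ X3 _] := mpinvP M.
have <- : mxrange (M *m X) = mxrange M by exact: (mxrange_eq X M).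
by apply: hermitian_orthogonal_projector => //; rewrite mulmxA X1.
Qed.

End MoorePenroseFactorizations.

Section GeneralizedInverse.
Context {C : numClosedFieldType} {n : nat} (A B : 'M[C]_n).
Local Notation P := (B *m mpinv B).
Local Notation X := (geninv A B).

Lemma adj_mulmx_proj : (A *m B *m mpinv B) ^t* = P *m A ^t*.
Proof.
by have /penroseP[_ _ hP _] := mpinvP B; rewrite -mulmxA trmxC_mul hP.
Qed.

(** The columns of X lie in R((A P)^H) = R(P A^H), hence in R(P). *)
Lemma geninv_absorb : P *m X = X.
Proof.
have /penroseP[PB _ _ _] := mpinvP B.
have PP : P *m P = P by rewrite mulmxA PB.
rewrite /geninv (mpinv_adjl (A *m B *m _)) adj_mulmx_proj.
by rewrite (mulmxA P) (mulmxA P P) PP.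
Qed.

Lemma mulmx_geninv : A *m X = A *m B *m mpinv B *m X.
Proof. by rewrite -{1}geninv_absorb !mulmxA. Qed.

(** Since A X = A P X, the outer inverse X of A P is one of A itself; this is
    what makes X A idempotent with the range of X. *)
Lemma geninv_outer : X *m A *m X = X.
Proof.
have /penroseP[_ XMX _ _] := mpinvP (A *m B *m mpinv B).
by rewrite -mulmxA mulmx_geninv mulmxA.
Qed.

Lemma mulmx_geninv_orthogonal :
  orthogonal_projector (A *m X) (mxrange (A *m B)).
Proof.
have /penroseP[PB _ _ _] := mpinvP B.
have -> : mxrange (A *m B) = mxrange (A *m B *m mpinv B).
  by apply: (mxrange_eq B (mpinv B)) => //; rewrite -!mulmxA (mulmxA B) PB.
by rewrite mulmx_geninv; exact: mulmx_mpinv_orthogonal.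
Qed.

Lemma geninv_mulmx_oblique :
  oblique_projector (X *m A)
    (mxrange (P *m A ^t*)) (mxnull (B ^t* *m A ^t* *m A)).
Proof.
have /penroseP[PB _ hP _] := mpinvP B.
split; first by rewrite mulmxA geninv_outer.
- have -> : mxrange (X *m A) = mxrange X.
    by apply: (mxrange_eq A X); rewrite ?geninv_outer.
  rewrite -adj_mulmx_proj.
  exact: mxrange_eq (mpinv_adjl _) (adj_mpinvl _).
- have -> : mxnull (X *m A) = mxnull (P *m A ^t* *m A).
    set M := A *m B *m mpinv B.
    rewrite -adj_mulmx_proj -/M.
    apply: (mxnull_eq (X *m X ^t*) (M ^t* *m M)).
      by rewrite mulmxA -mpinv_adjr.
    by rewrite mulmxA -adj_mpinvr.
  (* P = (B^+)^H B^H and B^H = B^H P, since P is Hermitian and P B = B. *)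
  apply: (mxnull_eq ((mpinv B) ^t*) (B ^t*)).
    by rewrite !mulmxA -trmxC_mul hP.
  have BP : B ^t* *m P = B ^t* by rewrite -hP -trmxC_mul PB.
  by rewrite -(mulmxA P) (mulmxA (B ^t*) P) BP mulmxA.
Qed.

End GeneralizedInverse.

Theorem theorem3p2 (R : realType) (n : nat) (A B : 'M[R[i]]_n) :
  orthogonal_projector (A *m geninv A B) (mxrange (A *m B)) /\
  oblique_projector (geninv A B *m A)
    (mxrange (B *m mpinv B *m A ^t*)) (mxnull (B ^t* *m A ^t* *m A)).
Proof.
by split; [exact: mulmx_geninv_orthogonal | exact: geninv_mulmx_oblique].
Qed.
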